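(* Let $X$ be a finite simple connected graph and $u,v \in V(X)$. If $u$ and $v$ are antipodal vertices, then $u$ and $v$ are spectrally extremal vertices and they are strongly cospectral. Conversely, if $u$ is spectrally extremal, $u$ and $v$ are strongly cospectral, and $d(u,v) = \varepsilon_u$, then $u$ and $v$ are antipodal vertices.
   Context: $A$ is the adjacency matrix of $X$ with spectral decomposition $A = \sum_r \theta_r E_r$ ($\theta_r$ distinct eigenvalues, $E_r$ orthogonal projections onto eigenspaces); $e_w$ is the standard basis vector of $w$. Eigenvalue support: $\Phi_u = \{\theta_r : E_r e_u \ne 0\}$; dual degree $d^*(u) = |\Phi_u|-1$; eccentricity $\varepsilon_u = \max_w d(u,w)$; $u$ is spectrally extremal if $\varepsilon_u = d^*(u)$ (in general $\varepsilon_u \le d^*(u)$). Vertices $u,v$ are cospectral if $X\setminus u$ and $X\setminus v$ have the same adjacency spectrum (equivalently $(E_r)_{u,u}=(E_r)_{v,v}$ for all $r$), and strongly cospectral if $E_r e_u = \pm E_r e_v$ for all $r$. Let $\varphi$ be the positive eigenvector of $A$ for its largest eigenvalue and $D = \mathrm{diag}(\varphi)$. A partition of $V(X)$ is pseudo equitable if for each class $C$ and each vertex $x$, the sum $\sum_{y \in C} (D^{-1}AD)_{x,y}$ depends only on the class containing $x$. The distance partition of $u$ is the partition of $V(X)$ into the sets $\{w : d(u,w) = i\}$. Vertices $u$ and $v$ are antipodal if: there is a pseudo equitable partition that is simultaneously the distance partition of $u$ and the distance partition of $v$; $\{u\}$ and $\{v\}$ are singleton classes of this partition at maximum distance from each other;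 and $u$ and $v$ are cospectral. *)

(* Defs.v *)
From HB Require Import structures.
From mathcomp Require Import all_boot all_order all_algebra.
Set Implicit Arguments. Unset Strict Implicit. Unset Printing Implicit Defensive.
Import Order.TTheory GRing.Theory Num.Theory.
Local Open Scope ring_scope.

Section Defs.
Variable R : rcfType.
Variable n : nat.
Notation V := 'I_n.+1.
Variable e : rel V.

Definition simple_graph : Prop := symmetric e /\ irreflexive e.
Definition connected_graph : Prop := forall u w : V, connect e u w.

Definition adj : 'M[R]_n.+1 := \matrix_(i, j) (e i j)%:R.

Fixpoint ball (k : nat) (u : V) : {set V} :=
  match k with
  | 0 => [set u]
  | k'.+1 => ball k' u :|: [set w | [exists x in ball k' u, e x w]]
  end.

Definition dist (u w : V) : nat := find (fun k => w \in ball k u) (iota 0 n.+1).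

Definition ecc (u : V) : nat := \max_(w : V) dist u w.

Definition evec (w : V) : 'cV[R]_n.+1 := delta_mx w ord0.

(* E is the family of orthogonal projections onto the eigenspaces of adj:
   E th is symmetric, idempotent, and has the eigenspace of th as its range
   (E th = 0 when th is not an eigenvalue). *)
Definition spectral_projections (E : R -> 'M[R]_n.+1) : Prop :=
  forall th : R, (E th)^T = E th /\ E th *m E th = E th
                 /\ (E th == eigenspace adj th)%MS.

(* eigenvalue support Phi_u has size d*(u)+1 and d*(u) = ecc u *)
Definition spectrally_extremal (E : R -> 'M[R]_n.+1) (u : V) : Prop :=
  exists s : seq R, [/\ uniq s,
    (forall th, th \in s <-> (eigenvalue adj th /\ E th *m evec u != 0))
    & (size s).-1 = ecc u].

Definition cospectral (u v : V) : Prop :=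
  char_poly (row' u (col' u adj)) = char_poly (row' v (col' v adj)).

Definition strongly_cospectral (E : R -> 'M[R]_n.+1) (u v : V) : Prop :=
  forall th : R, E th *m evec u = E th *m evec v \/ E th *m evec u = - (E th *m evec v).

Definition perron_vector (phi : 'cV[R]_n.+1) : Prop :=
  (forall i, 0 < phi i ord0) /\
  exists rho : R, adj *m phi = rho *: phi /\ eigenvalue adj rho /\
                  forall th, eigenvalue adj th -> th <= rho.

(* D^{-1} A D with D = diag(phi) *)
Definition DAD (phi : 'cV[R]_n.+1) : 'M[R]_n.+1 :=
  \matrix_(x, y) ((phi x ord0)^-1 * adj x y * phi y ord0).

Definition pseudo_equitable (phi : 'cV[R]_n.+1) (P : {set {set V}}) : Prop :=
  forall C B : {set V}, C \in P -> B \in P ->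
  forall x y, x \in B -> y \in B ->
    \sum_(z in C) DAD phi x z = \sum_(z in C) DAD phi y z.

Definition distance_partition (u : V) : {set {set V}} :=
  [set [set w | dist u w == dist u x] | x : V].

Definition antipodal (phi : 'cV[R]_n.+1) (u v : V) : Prop :=
  [/\ distance_partition u = distance_partition v,
      pseudo_equitable phi (distance_partition u),
      [set u] \in distance_partition u /\ [set v] \in distance_partition u,
      dist u v = ecc u & cospectral u v].

End Defs.

(* Main.v *)
(* Write A for the adjacency matrix and p(u) for p(A) e_u. By the spectral
   theorem p(u) = 0 iff p vanishes on Phi_u, and p(u) is supported on the ball
   of radius deg p around u; this gives ecc u < |Phi_u|.

   If the distance partition of u is pseudo equitable, the restriction z_i of
   phi to the i-th distance class satisfies a recurrence expressing A z_i
   through z_0, ..., z_(i+1). Hence z_i = p_i(u) with deg p_i = i, and the last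
   step produces a polynomial of degree ecc u + 1 vanishing on Phi_u, so u is
   extremal. When the last class is {v} we get e_v = q(u), so that
   E_th e_v = q(th) E_th e_u, and cospectrality forces q(th)^2 = 1.

   Conversely, let d = ecc u = dist u v and U = {p(u)} = {p(v)}, of dimension
   d + 1. Counting dimensions, some nonzero x_i in U is both a p(u) with
   deg p <= i and a p(v) with deg p <= d - i, so it lives on the vertices at
   distance i from u and d - i from v. The x_i have disjoint supports, hence
   form a basis of U. As phi is in U and has no zero entry, every vertex lies on
   a geodesic from u to v and x_i is a multiple of z_i; A-invariance of U is
   then pseudo equitability. *)
Require Import Defs.
From HB Require Import structures.
From mathcomp Require Import all_boot all_order all_algebra.
From mathcomp Require Import complex zify ring.
Import Order.TTheory GRing.Theory Num.Theory.
Local Open Scope ring_scope.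
Set Implicit Arguments. Unset Strict Implicit. Unset Printing Implicit Defensive.

(** * The spectral decomposition of a symmetric matrix *)

(** Over the complex extension of [R] the matrix is Hermitian, hence unitarily diagonalizable with
    real eigenvalues. The product of the X - r over these distinct values then annihilates [A] over
    [R], so the minimal polynomial splits with simple roots. *)
Lemma symmetric_diagonalizable (R : rcfType) (n : nat) (A : 'M[R]_n.+1) :
  A^T = A -> diagonalizable A.
Proof.
move=> symA; pose f := real_complex R; pose B := map_mx f A.
have Bherm : B \is hermsymmx.
  apply: realsym_hermsym.
    apply/is_hermitianmxP; rewrite expr0 scale1r map_mx_id //. by rewrite /B map_trmx symA.
  apply/mxOverP=> i j; rewrite mxE complex_real //.
have /mxOverP dreal := hermitian_spectral_diag_real Bherm.
have /orthomx_spectralP := hermitian_normalmx Bherm.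
set P := spectralmx B; set d := spectral_diag B => defB.
have Punit : P \in unitmx by apply: spectral_unit.
pose rs := undup [seq complex.Re (d 0 i) | i <- enum 'I_n.+1].
apply/diagonalizableP; exists rs; first exact: undup_uniq.
apply: mxminpoly_min; apply: (@map_mx_inj _ _ f).
rewrite map_horner_mx -/B defB map_mx0.
have -> : invmx P *m diag_mx d *m P = invmx P *m diag_mx d *m invmx (invmx P).
  by rewrite invmxK.
rewrite horner_mx_uconj ?unitmx_inv // horner_mx_diag.
suff -> : map_mx (horner (map_poly f (\prod_(x <- rs) ('X - x%:P)))) d = 0.
  by rewrite linear0 mulmx0 mul0mx.
apply/matrixP => i j; rewrite !mxE (ord1 i) rmorph_prod horner_prod.
have dj : complex.Re (d 0 j) \in rs.
  by rewrite mem_undup; apply/mapP; exists j => //; rewrite mem_enum.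
rewrite (big_rem _ dj) /= rmorphB /= map_polyX map_polyC /= hornerXsubC.
have -> : d 0 j = f (complex.Re (d 0 j)) by rewrite /f RRe_real.
by rewrite subrr mul0r.
Qed.

Section SpectralDecomposition.
Variables (R : rcfType) (n : nat) (A : 'M[R]_n.+1) (E : R -> 'M[R]_n.+1).
Hypothesis A_sym : A^T = A.
Hypothesis E_proj : forall th, (E th)^T = E th /\ E th *m E th = E th
                               /\ (E th == eigenspace A th)%MS.
Implicit Types (th : R) (p : {poly R}) (x : 'cV[R]_n.+1) (s : seq R).

Lemma trmx_proj th : (E th)^T = E th. Proof. by have [] := E_proj th. Qed.

Lemma proj_idem th : E th *m E th = E th. Proof. by have [_ []] := E_proj th. Qed.

(** [eigenspace] is a row space, so this side is immediate; symmetry transports it to columns. *)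
Lemma mul_proj_mx th : E th *m A = th *: E th.
Proof. by have [_ [_ /andP[]]] := E_proj th; move/eigenspaceP. Qed.

Lemma mul_mx_proj th : A *m E th = th *: E th.
Proof. by apply: trmx_inj; rewrite trmx_mul linearZ /= trmx_proj A_sym mul_proj_mx. Qed.

Lemma proj_ortho a b : a != b -> E a *m E b = 0.
Proof.
move=> ab; have : (a - b) *: (E a *m E b) = 0.
  by rewrite scalerBl !scalemxAl -mul_proj_mx -mulmxA mul_mx_proj -!scalemxAl -scalemxAr subrr.
by move/eqP; rewrite scaler_eq0 subr_eq0 (negPf ab) => /eqP.
Qed.

Lemma proj_fix th x : A *m x = th *: x -> E th *m x = x.
Proof.
move=> Ax; have : (x^T <= E th)%MS.
  have [_ [_ /andP[_ h]]] := E_proj th; apply: submx_trans h.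
  by apply/eigenspaceP; rewrite -[in LHS]A_sym -trmx_mul Ax linearZ.
case/submxP => D xD; apply: trmx_inj.
by rewrite trmx_mul trmx_proj xD -mulmxA proj_idem.
Qed.

Lemma proj_eigenvalue th : eigenvalue A th = (E th != 0).
Proof.
rewrite /eigenvalue; have [_ [_ /eqmxP h]] := E_proj th.
by rewrite -!mxrank_eq0 h.
Qed.

(** Diagonalizability says that the eigenspaces span the whole space; by orthogonality the sum of
    the projections fixes each of them. *)
Lemma sum_proj : exists rs, uniq rs /\ \sum_(r <- rs) E r = 1%:M.
Proof.
have /diagonalizablePeigen[rs urs rs1] := symmetric_diagonalizable A_sym.
exists rs; split => //; set M := \sum_(r <- rs) _.
suff : (1%:M <= kermx (M - 1%:M))%MS by move/sub_kermxP; rewrite mul1mx => /subr0_eq.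
rewrite -rs1 big_seq; elim/big_ind: _ => [|U V hU hV|r rrs]; first exact: sub0mx.
  by rewrite addsmx_sub hU.
have [_ [_ /andP[_ h]]] := E_proj r; apply: submx_trans h _.
apply/sub_kermxP; rewrite mulmxBr mulmx1 mulmx_sumr (bigD1_seq r) //=.
rewrite proj_idem big1 ?addr0 ?subrr // => t tr.
by rewrite proj_ortho // eq_sym.
Qed.

Lemma mul_proj_horner th p : E th *m horner_mx A p = p.[th] *: E th.
Proof.
elim/poly_ind: p => [|p c IH]; first by rewrite rmorph0 mulmx0 horner0 scale0r.
rewrite rmorphD rmorphM /= horner_mx_X horner_mx_C mulmxDr mulmxA IH.
by rewrite -scalemxAl mul_proj_mx mul_mx_scalar scalerA -scalerDl !hornerE.
Qed.

Definition eigenvalue_support x s := forall th, (th \in s) = (E th *m x != 0).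

Lemma eigenvalue_supportP x s :
  (forall th, th \in s <-> (eigenvalue A th /\ E th *m x != 0)) <->
  eigenvalue_support x s.
Proof.
have H th : E th *m x != 0 -> eigenvalue A th.
  by rewrite proj_eigenvalue; apply: contraNneq => ->; rewrite mul0mx.
split=> hs th.
  by apply/idP/idP => [/hs[]//|h]; apply/hs; split => //; apply: H.
by rewrite hs; split=> [h|[]//]; split => //; apply: H.
Qed.

Lemma eigenvalue_support_exists x : exists s, uniq s /\ eigenvalue_support x s.
Proof.
have [rs [urs rs1]] := sum_proj.
exists [seq th <- rs | E th *m x != 0]; split; first exact: filter_uniq.
move=> th; rewrite mem_filter; case: eqP => //= /eqP Ex; apply/negPn/negP => thrs.
case/negP: Ex; rewrite -[E th]mulmx1 -rs1 mulmx_sumr big_seq big1 ?mul0mx //.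
by move=> r rrs; rewrite proj_ortho //; apply: contraNneq thrs => ->.
Qed.

(** p(A) x is the sum of the p(r) E_r x, and each coefficient is recovered by applying E_r. *)
Lemma horner_mx_vec_eq0 x s p : eigenvalue_support x s ->
  (horner_mx A p *m x == 0) = all (root p) s.
Proof.
move=> hs; apply/eqP/allP => [px0 th|ps].
  rewrite hs => Ex; have := congr1 (mulmx (E th)) px0.
  rewrite mulmxA mul_proj_horner mulmx0 -scalemxAl => /eqP.
  by rewrite scaler_eq0 (negPf Ex) orbF.
have [rs [_ rs1]] := sum_proj.
rewrite -[horner_mx A p]mul1mx -rs1 mulmx_suml mulmx_suml big1 // => r _.
rewrite mul_proj_horner -scalemxAl; have [->|Ex] := eqVneq (E r *m x) 0.
  by rewrite scaler0.
by move: (Ex); rewrite -hs => /ps /rootP ->; rewrite scale0r.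
Qed.

Lemma cofactor_char_poly_mx u :
  (\adj (char_poly_mx A)) u u = char_poly (row' u (col' u A)).
Proof. by rewrite mxE /cofactor row'_col'_char_poly_mx addnn -signr_odd odd_double mul1r. Qed.

(* Over R[X], (X - A)^-1 = sum_r E_r / (X - r), and its (u, u) entry is
   the characteristic polynomial of A with u deleted over that of A. *)
Lemma cospectral_proj u v :
  char_poly (row' u (col' u A)) = char_poly (row' v (col' v A)) <->
  forall th, E th u u = E th v v.
Proof.
have [rs [urs rs1]] := sum_proj.
pose m := \prod_(r <- rs) ('X - r%:P).
pose mr r := \prod_(t <- rem r rs) ('X - t%:P).
have mE r : r \in rs -> ('X - r%:P) * mr r = m.
  by move=> rrs; rewrite /m (big_rem _ rrs).
(* [N] is the resolvent (X - A)^-1 multiplied by [m] to clear denominators. *)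
pose N := \sum_(r <- rs) mr r *: map_mx polyC (E r).
have pN : char_poly_mx A *m N = m%:M.
  rewrite mulmx_sumr -[m%:M]scalemx1.
  have -> : 1%:M = \sum_(r <- rs) map_mx (@polyC R) (E r).
    by rewrite -(map_mx1 polyC) -rs1 raddf_sum.
  rewrite scaler_sumr big_seq [RHS]big_seq; apply: eq_bigr => r rrs.
  rewrite -scalemxAr mulmxBl mul_scalar_mx -map_mxM mul_mx_proj map_mxZ.
  by rewrite -scalerBl scalerA mulrC mE.
have key w : char_poly A * N w w = m * char_poly (row' w (col' w A)).
  have : \adj (char_poly_mx A) *m (char_poly_mx A *m N) = m *: \adj (char_poly_mx A).
    by rewrite pN mul_mx_scalar.
  rewrite mulmxA mul_adj_mx mul_scalar_mx => /matrixP/(_ w w).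
  by rewrite mxE [RHS]mxE cofactor_char_poly_mx.
have NE w : N w w = \sum_(r <- rs) mr r * (E r w w)%:P.
  by rewrite summxE; apply: eq_bigr => r _; rewrite !mxE.
have m0 : m != 0 by rewrite monic_neq0 // monic_prod_XsubC.
split=> [cuv th|Euv]; last first.
  apply: (mulfI m0); rewrite -!key !NE; congr (_ * _).
  by apply: eq_bigr => r _; rewrite Euv.
have Nuv : N u u = N v v.
  by apply: (mulfI (monic_neq0 (char_poly_monic A))); rewrite !key cuv.
have [thrs|thrs] := boolP (th \in rs); last first.
  suff -> : E th = 0 by rewrite !mxE.
  rewrite -[E th]mulmx1 -rs1 mulmx_sumr big_seq big1 // => r rrs.
  by rewrite proj_ortho //; apply: contraNneq thrs => ->.
(* At th every other [mr r] vanishes, so E_th is read off from [N] like a residue. *)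
have Nth w : (N w w).[th] = (mr th).[th] * E th w w.
  rewrite NE horner_sum (bigD1_seq th) //= hornerM hornerC big_seq_cond big1 ?addr0 //.
  move=> r /andP[rrs rth]; rewrite hornerM.
  suff -> : (mr r).[th] = 0 by rewrite mul0r.
  by apply/rootP; rewrite root_prod_XsubC mem_rem_uniq // inE eq_sym rth.
apply: (@mulfI _ (mr th).[th]); last by rewrite -!Nth Nuv.
by rewrite -/(root _ _) root_prod_XsubC mem_rem_uniq // inE eqxx.
Qed.

End SpectralDecomposition.

(** * Distances *)

Section Distance.
Variables (n : nat) (e : rel 'I_n.+1).
Hypotheses (e_sym : symmetric e) (e_conn : connected_graph e).
Implicit Types u v w x : 'I_n.+1.

Lemma in_ballS k u w :
  (w \in ball e k.+1 u) = (w \in ball e k u) || [exists x in ball e k u, e x w].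
Proof. by rewrite /= !inE. Qed.

Lemma ball_mono k l u w : (k <= l)%N -> w \in ball e k u -> w \in ball e l u.
Proof.
move=> /subnK <-; elim: (l - k)%N => // m IH /IH Hw.
by rewrite addSn in_ballS Hw.
Qed.

Lemma ball_path u p : path e u p -> last u p \in ball e (size p) u.
Proof.
elim/last_ind: p => [|p y IH]; first by rewrite /= !inE.
rewrite rcons_path last_rcons size_rcons => /andP[/IH pu ey].
by rewrite in_ballS; apply/orP; right; apply/existsP; exists (last u p); rewrite pu.
Qed.

(** A path without repeated vertices has at most n edges. *)
Lemma ball_full u w : w \in ball e n u.
Proof.
have /connectP[p ep ->] := e_conn u w.
case/shortenP: ep => q eq uq _; apply: ball_mono (ball_path eq).
by have /= := max_card (mem (u :: q)); rewrite card_ord (card_uniqP uq).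
Qed.

(** If no ball contained w, [find] in [dist] would return n.+1; connectedness excludes this
    default. *)
Lemma dist_le_n u w : (dist e u w <= n)%N.
Proof.
rewrite leqNgt; apply/negP => /(before_find 0%N).
by rewrite nth_iota ?add0n ?ball_full.
Qed.

Lemma in_ball k u w : (w \in ball e k u) = (dist e u w <= k)%N.
Proof.
apply/idP/idP => [wk|].
  have [kn|] := leqP k n; last by move/ltnW; apply: leq_trans (dist_le_n _ _).
  rewrite leqNgt; apply/negP => /(before_find 0%N).
  by rewrite nth_iota ?add0n ?wk.
move/ball_mono; apply; rewrite /dist; set a := fun k => _.
have ha : has a (iota 0 n.+1).
  by apply/hasP; exists n; rewrite ?mem_iota ?leqnn ?ltnSn // /a ball_full.
have := nth_find 0%N ha; rewrite nth_iota ?add0n //.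
by move: ha; rewrite has_find size_iota.
Qed.

Lemma dist_eq0 u w : (dist e u w == 0)%N = (w == u).
Proof. by rewrite -leqn0 -in_ball /= inE. Qed.

Lemma dist_edge u x w : e x w -> (dist e u w <= (dist e u x).+1)%N.
Proof.
move=> exw; rewrite -in_ball in_ballS; apply/orP; right.
by apply/existsP; exists x; rewrite in_ball leqnn.
Qed.

Lemma dist_pred u w k :
  dist e u w = k.+1 -> exists2 x, dist e u x = k & e x w.
Proof.
move=> dk; have : w \in ball e k.+1 u by rewrite in_ball dk.
rewrite in_ballS in_ball dk ltnn /= => /existsP[x /andP[]].
rewrite in_ball => xk exw; exists x => //; apply/eqP; rewrite eqn_leq xk /=.
by have := dist_edge u exw; rewrite dk ltnS.
Qed.

Lemma dist_triangle u x w : (dist e u w <= dist e u x + dist e x w)%N.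
Proof.
move: {-1}(dist e x w) (leqnn (dist e x w)) => k; elim: k w => [|k IH] w.
  by rewrite leqn0 dist_eq0 => /eqP ->; rewrite addn0.
rewrite leq_eqVlt => /orP[/eqP/dist_pred[y yk eyw]|]; last first.
  by rewrite ltnS => /IH H; apply: leq_trans H _; rewrite leq_add2l.
apply: leq_trans (dist_edge u eyw) _; rewrite addnS ltnS; apply: IH.
by rewrite yk.
Qed.

(** Balls grow from their centre, so symmetry needs an induction: the last edge of a geodesic from y
    to x becomes the first step from x. *)
Lemma dist_sym u w : dist e u w = dist e w u.
Proof.
suff H x y : (dist e x y <= dist e y x)%N by apply/eqP; rewrite eqn_leq !H.
move: {-1}(dist e y x) (leqnn (dist e y x)) => k.
elim: k x y => [|k IH] x y.
  by rewrite leqn0 dist_eq0 => /eqP ->; rewrite leqn0 dist_eq0.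
rewrite leq_eqVlt => /orP[/eqP/dist_pred[z zk ezx]|]; last first.
  by rewrite ltnS => /IH /leq_trans; apply.
apply: leq_trans (dist_triangle x z y) _; rewrite -add1n.
apply: leq_add; last by apply: IH; rewrite zk.
rewrite e_sym in ezx; apply: leq_trans (dist_edge x ezx) _.
by rewrite ltnS leqn0 dist_eq0.
Qed.

Lemma dist_le_ecc u w : (dist e u w <= ecc e u)%N.
Proof. exact: leq_bigmax. Qed.

Lemma ecc_attained u : exists w, dist e u w = ecc e u.
Proof.
rewrite /ecc; have [|w ->] := @bigop.eq_bigmax 'I_n.+1 (dist e u); first by rewrite card_ord.
by exists w.
Qed.

Lemma dist_surj u i : (i <= ecc e u)%N -> exists w, dist e u w = i.
Proof.
have [w <-] := ecc_attained u.
move: {-1}(dist e u w) (erefl (dist e u w)) => k.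
elim: k w => [|k IH] w dk; first by rewrite leqn0 => /eqP ->; exists w.
rewrite leq_eqVlt => /orP[/eqP -> |]; first by exists w.
by have [x xk _] := dist_pred dk; apply: IH xk.
Qed.

End Distance.

(** * Walks and pseudo equitable distance partitions *)

Section Walks.
Variables (R : rcfType) (n : nat) (e : rel 'I_n.+1).
Hypotheses (e_sym : symmetric e) (e_conn : connected_graph e).
Local Notation A := (adj R e).
Local Notation evec := (evec R).
Local Notation dist := (dist e).
Implicit Types (u v w x : 'I_n.+1) (p : {poly R}) (k : nat).

Lemma adj_sym : A^T = A.
Proof. by apply/matrixP => i j; rewrite !mxE e_sym. Qed.

Lemma adj_mul_col (c : 'cV[R]_n.+1) w :
  (A *m c) w 0 = \sum_(x | e w x) c x 0.
Proof.
rewrite mxE [RHS]big_mkcond /=; apply: eq_bigr => x _.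
by rewrite mxE; case: (e w x); rewrite ?mul1r ?mul0r.
Qed.

Lemma adj_powS k u : A ^+ k.+1 *m evec u = A *m (A ^+ k *m evec u).
Proof. by rewrite exprS mulmxA. Qed.

Lemma adj_pow_ge0 k u w : 0 <= (A ^+ k *m evec u) w 0.
Proof.
elim: k w => [|k IH] w; first by rewrite expr0 mul1mx mxE ler0n.
by rewrite adj_powS adj_mul_col sumr_ge0.
Qed.

(** Entry w of A^k e_u counts the walks of length k from u to w. *)
Lemma adj_pow_eq0 k u w : (k < dist u w)%N -> (A ^+ k *m evec u) w 0 = 0.
Proof.
elim: k w => [|k IH] w kw.
  have /negPf wu : w != u by rewrite -(dist_eq0 e_conn) -lt0n.
  by rewrite expr0 mul1mx mxE wu.
rewrite adj_powS adj_mul_col big1 // => x; rewrite e_sym => exw.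
by apply: IH; rewrite -ltnS (leq_trans kw) // dist_edge.
Qed.

Lemma adj_pow_gt0 u w : 0 < (A ^+ (dist u w) *m evec u) w 0.
Proof.
move: {-1}(dist u w) (erefl (dist u w)) => k.
elim: k w => [|k IH] w kw.
  by move/eqP: kw; rewrite dist_eq0 // => /eqP ->; rewrite expr0 mul1mx mxE !eqxx ltr01.
have [x /IH xk exw] := dist_pred e_conn kw; rewrite e_sym in exw.
rewrite adj_powS adj_mul_col (bigD1 x) //= ltr_wpDr // sumr_ge0 // => y _.
exact: adj_pow_ge0.
Qed.

Lemma horner_adjE p u :
  horner_mx A p *m evec u = \sum_(i < size p) p`_i *: (A ^+ i *m evec u).
Proof.
rewrite -[in LHS](coefK p) poly_def rmorph_sum mulmx_suml; apply: eq_bigr => i _.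
by rewrite /= horner_mxZ rmorphXn /= horner_mx_X scalemxAl.
Qed.

(** Among the powers up to the distance, only the top one reaches w. *)
Lemma horner_adj_far p u w :
  (size p <= (dist u w).+1)%N ->
  (horner_mx A p *m evec u) w 0
    = p`_(dist u w) * (A ^+ (dist u w) *m evec u) w 0.
Proof.
move=> sp; rewrite horner_adjE (big_ord_widen _ (fun i => p`_i *: (A ^+ i *m evec u)) sp).
rewrite big_mkcond summxE big_ord_recr /= big1 ?add0r; last first.
  move=> i _; case: ifP => _; last by rewrite mxE.
  by rewrite mxE adj_pow_eq0 ?mulr0.
by case: ltnP => [_|h]; rewrite mxE // nth_default ?mul0r.
Qed.

Lemma horner_adj_eq0 p k u w : (size p <= k.+1)%N -> (k < dist u w)%N ->
  (horner_mx A p *m evec u) w 0 = 0.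
Proof.
move=> sp kw; rewrite horner_adj_far; last by apply: leq_trans sp _; rewrite ltnS ltnW.
by rewrite nth_default ?mul0r // (leq_trans sp).
Qed.

Section Spectral.
Variable E : R -> 'M[R]_n.+1.
Hypothesis E_proj : spectral_projections e E.

(** Otherwise some w is at distance |s| from u. The monic polynomial with root set [s] annihilates
    e_u, yet its value at w is the positive number of geodesics. *)
Lemma ecc_lt_support u s : uniq s -> eigenvalue_support E (evec u) s ->
  (ecc e u < size s)%N.
Proof.
move=> us hs; rewrite ltnNge; apply/negP => /(dist_surj e_conn)[w dw].
pose q := \prod_(t <- s) ('X - t%:P).
have := horner_mx_vec_eq0 adj_sym E_proj q hs.
have -> : all (root q) s by apply/allP => t ts; rewrite root_prod_XsubC.
move=> /eqP/matrixP/(_ w 0); rewrite horner_adj_far ?dw ?size_prod_XsubC // [RHS]mxE.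
have -> : q`_(size s) = 1.
  by have /monicP := monic_prod_XsubC s xpredT id; rewrite /lead_coef size_prod_XsubC.
by rewrite mul1r -dw => Aw0; have := adj_pow_gt0 u w; rewrite Aw0 ltxx.
Qed.

(** Since E = E^T E, a diagonal entry is the squared norm of a projected basis vector. *)
Lemma proj_evec_diag th u : (E th) u u = \sum_w ((E th *m evec u) w 0) ^+ 2.
Proof.
rewrite -[in LHS](proj_idem E_proj) mxE; apply: eq_bigr => w _.
by rewrite -{1}(trmx_proj E_proj) mxE -colE mxE expr2.
Qed.

(** * Distance layers as polynomials in A applied to e_u *)

Section PseudoEquitable.
Variables (phi : 'cV[R]_n.+1) (u : 'I_n.+1).
Hypotheses (phi_gt0 : forall i, 0 < phi i ord0)
           (phi_eq : pseudo_equitable e phi (distance_partition e u)).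

(** The vector z_i, the restriction of phi to the i-th distance class. *)
Definition layer i : 'cV[R]_n.+1 := \col_w (phi w 0 *+ (dist u w == i)).

Lemma adj_layer i w :
  (A *m layer i) w 0 = phi w 0 * \sum_(y in [set y | dist u y == i]) DAD e phi w y.
Proof.
rewrite mxE mulr_sumr [RHS]big_mkcond /=; apply: eq_bigr => y _.
rewrite !mxE inE; case: ifP => _; last by rewrite mulr0.
by rewrite !mulrA divff ?mul1r // gt_eqF.
Qed.

Lemma adj_layer_far i w : (i.+1 < dist u w)%N -> (A *m layer i) w 0 = 0.
Proof.
move=> iw; rewrite adj_mul_col big1 // => y; rewrite e_sym => eyw; rewrite mxE.
case: eqP => // yi; have := dist_edge e_conn u eyw.
by rewrite yi leqNgt iw.
Qed.

Lemma layer_class i : (i <= ecc e u)%N -> [set w | dist u w == i] \in distance_partition e u.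
Proof. by move=> /(dist_surj e_conn)[w <-]; apply/imsetP; exists w. Qed.

(** Class sums are constant on classes, so A z_i combines layers, and an edge climbs at most one
    layer. The top coefficient is positive because a vertex in layer i+1 has a neighbour in layer
    i. *)
Lemma adj_layer_recurrence i : (i <= ecc e u)%N ->
  exists b : nat -> R,
    A *m layer i = \sum_(j < i.+2) b j *: layer j
    /\ ((i < ecc e u)%N -> 0 < b i.+1).
Proof.
(* The default [u] is reached only for an empty class, whose layer is the zero vector. *)
move=> id; pose rep j := odflt u [pick w | dist u w == j].
pose C := [set y | dist u y == i].
pose b j := \sum_(y in C) DAD e phi (rep j) y.
have bE w : (A *m layer i) w 0 = phi w 0 * b (dist u w).
  rewrite adj_layer; congr (_ * _).
  apply: (phi_eq (layer_class id) (layer_class (dist_le_ecc e u w))); rewrite inE //.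
  by rewrite /rep; case: pickP => [x //|/(_ w)]; rewrite eqxx.
exists b; split.
  apply/matrixP => w k; rewrite (ord1 k) summxE.
  have [iw|iw] := ltnP i.+1 (dist u w).
    rewrite adj_layer_far // big1 // => j _; rewrite !mxE; case: eqP => [dj|]; last by rewrite mulr0.
    by have := ltn_ord j; rewrite -dj ltnNge iw.
  rewrite bE (bigD1 (Ordinal (n := i.+2) iw)) //= !mxE eqxx mulr1n mulrC.
  rewrite big1 ?addr0 // => j /negPf jw; rewrite !mxE eq_sym.
  by move: jw; rewrite -(inj_eq val_inj) /= => ->; rewrite mulr0.
move=> /(dist_surj e_conn)[w dw].
have := bE w; rewrite dw => bw.
rewrite -(pmulr_rgt0 _ (phi_gt0 w)) -bw adj_mul_col.
have [x xi exw] := dist_pred e_conn dw; rewrite e_sym in exw.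
rewrite (bigD1 x) //= mxE xi eqxx ltr_pwDl //.
  exact: phi_gt0.
by apply: sumr_ge0 => y _; rewrite mxE mulrn_wge0 // ltW.
Qed.

Lemma layer_combination k (b : nat -> R) :
  (forall j, (j < k)%N -> exists p : {poly R},
     size p = j.+1 /\ horner_mx A p *m evec u = layer j) ->
  exists q : {poly R}, (size q <= k)%N /\
    horner_mx A q *m evec u = \sum_(j < k) b j *: layer j.
Proof.
move=> h; have [f fP] := fin_all_exists (fun j : 'I_k => h j (ltn_ord j)).
exists (\sum_(j < k) b j *: f j); split.
  apply: leq_trans (size_sum _ _ _) _; apply/bigmax_leqP => j _.
  by apply: leq_trans (size_scale_leq _ _) _; have [-> _] := fP j; apply: ltn_ord.
rewrite rmorph_sum mulmx_suml; apply: eq_bigr => j _.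
by rewrite /= horner_mxZ -scalemxAl; have [_ ->] := fP j.
Qed.

(** Solves the recurrence for its top term: [q] cancels the layers up to i, and its degree is too
    small to affect that of ['X * p]. *)
Lemma layer_step i (b : nat -> R) (p q : {poly R}) :
  A *m layer i = \sum_(j < i.+2) b j *: layer j ->
  size p = i.+1 -> horner_mx A p *m evec u = layer i ->
  (size q <= i.+1)%N -> horner_mx A q *m evec u = \sum_(j < i.+1) b j *: layer j ->
  size ('X * p - q) = i.+2 /\
  horner_mx A ('X * p - q) *m evec u = b i.+1 *: layer i.+1.
Proof.
move=> Ai sp pi sq qi; split.
  have sXp : size ('X * p) = i.+2.
    by rewrite mulrC size_mulX ?sp // -size_poly_gt0 sp.
  by rewrite size_polyDl // size_polyN sXp ltnS.
rewrite rmorphB rmorphM /= horner_mx_X mulmxBl -mulmxA pi qi Ai big_ord_recr /=.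
by rewrite addrAC subrr add0r.
Qed.

Lemma layer_poly i : (i <= ecc e u)%N ->
  exists p : {poly R}, size p = i.+1 /\ horner_mx A p *m evec u = layer i.
Proof.
elim/ltn_ind: i => -[|i] IH id.
  exists (phi u 0)%:P; split; first by rewrite size_polyC gt_eqF.
  apply/matrixP => w k; rewrite (ord1 k) horner_mx_C mul_scalar_mx !mxE dist_eq0 //.
  by case: eqP => [->|]; rewrite /= ?mulr1 ?mulr0.
have [b [Ai /(_ id) bi]] := adj_layer_recurrence (ltnW id).
have [p [sp pi]] := IH i (ltnSn i) (ltnW id).
have [j ji|q [sq qi]] := @layer_combination i.+1 b.
  by apply: IH => //; apply: leq_trans (ltnW ji) id.
have [s1 s2] := layer_step Ai sp pi sq qi.
exists ((b i.+1)^-1 *: ('X * p - q)); split; first by rewrite size_scale // invr_eq0 gt_eqF.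
by rewrite horner_mxZ -scalemxAl s2 scalerA mulVf ?scale1r // gt_eqF.
Qed.

Lemma pseudo_equitable_extremal : spectrally_extremal e E u.
Proof.
have [s [us hs]] := eigenvalue_support_exists adj_sym E_proj (evec u).
exists s; split => //; first by apply/(eigenvalue_supportP E_proj).
suff : (size s < (ecc e u).+2)%N.
  rewrite ltnS => s1; have s2 := ecc_lt_support us hs.
  by have /eqP -> : size s == (ecc e u).+1 by rewrite eqn_leq s1.
have d := leqnn (ecc e u).
have [b [Ad _]] := adj_layer_recurrence d.
have [p [sp pd]] := layer_poly d.
have [j jd|q [sq qd]] := @layer_combination (ecc e u).+1 b; first exact: layer_poly.
have [<- s2] := layer_step Ad sp pd sq qd.
have s1 : size ('X * p - q) = (ecc e u).+2 by have [] := layer_step Ad sp pd sq qd.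
apply: max_poly_roots us; first by rewrite -size_poly_gt0 s1.
rewrite -(horner_mx_vec_eq0 adj_sym E_proj _ hs) s2.
(* Layer ecc+1 is empty, so this polynomial of degree ecc+1 annihilates e_u and has all of [s] among
   its roots. *)
apply/eqP/matrixP => w k; rewrite !mxE.
by rewrite ltn_eqF ?mulr0 // ltnS dist_le_ecc.
Qed.

Lemma singleton_layer_poly v :
  [set w | dist u w == dist u v] = [set v] ->
  exists q : {poly R}, horner_mx A q *m evec u = evec v.
Proof.
move=> hv; have [p [_ pv]] := layer_poly (dist_le_ecc e u v).
exists ((phi v 0)^-1 *: p); rewrite horner_mxZ -scalemxAl pv.
apply/matrixP => w k; rewrite (ord1 k) !mxE.
move/setP/(_ w): hv; rewrite !inE => ->; case: eqP => [->|]; last by rewrite mulr0.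
by rewrite eqxx mulVf // gt_eqF //; apply: phi_gt0.
Qed.

End PseudoEquitable.

Lemma cospectral_strongly u v (q : {poly R}) :
  horner_mx A q *m evec u = evec v -> cospectral R e u v ->
  strongly_cospectral E u v.
Proof.
move=> quv /(cospectral_proj adj_sym E_proj) cuv th.
have Ev : E th *m evec v = q.[th] *: (E th *m evec u).
  by rewrite -quv mulmxA (mul_proj_horner E_proj) scalemxAl.
have := cuv th; rewrite !proj_evec_diag Ev; set c := q.[th]; set x := E th *m evec u.
have -> : \sum_w (c *: x) w 0 ^+ 2 = c ^+ 2 * \sum_w x w 0 ^+ 2.
  by rewrite mulr_sumr; apply: eq_bigr => w _; rewrite mxE exprMn.
move/eqP; rewrite -subr_eq0 -{1}[\sum__ _]mul1r -mulrBl mulf_eq0 subr_eq0 => /orP[|].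
  rewrite eq_sym sqrf_eq1 => /orP[] /eqP ->; first by left; rewrite scale1r.
  by right; rewrite scaleN1r opprK.
(* Remaining case: E_th e_u has norm zero, so both projections vanish. *)
rewrite psumr_eq0 => [/allP x0|w _]; last exact: sqr_ge0.
suff -> : x = 0 by left; rewrite scaler0.
apply/matrixP => w k; rewrite (ord1 k) [RHS]mxE; apply/eqP; rewrite -sqrf_eq0.
by apply: x0; rewrite mem_index_enum.
Qed.

End Spectral.
End Walks.

(** * Strongly cospectral vertices at maximum distance *)

Lemma horner_rVpoly_sum (R : comNzRingType) k (c : 'rV[R]_k) (x : R) :
  (rVpoly c).[x] = \sum_(i < k) c 0 i * x ^+ i.
Proof.
rewrite horner_poly; apply: eq_bigr => i _; congr (_ * _).
by case: insubP => [j _ ji|]; [congr (c 0 _); apply: val_inj | rewrite ltn_ord].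
Qed.

Lemma poly_eq0_of_roots (R : idomainType) (p : {poly R}) (s : seq R) :
  uniq s -> all (root p) s -> (size p <= size s)%N -> p = 0.
Proof.
move=> us ps sp; apply: contraTeq sp => p0.
by rewrite -ltnNge; apply: max_poly_roots p0 ps us.
Qed.

Lemma rVpoly_eq0 (R : nzRingType) k (c : 'rV[R]_k) : rVpoly c = 0 -> c = 0.
Proof. by move=> c0; rewrite -(rVpolyK c) c0 linear0. Qed.

(* k + l unknown coefficients against size s < k + l linear conditions. *)
Lemma pade_interpolation (F : fieldType) (s : seq F) (f : F -> F) (k l : nat) :
  uniq s -> (forall x, x \in s -> f x != 0) -> (k <= size s)%N -> (l <= size s)%N -> (size s < k + l)%N ->
  exists p q : {poly F}, [/\ (size p <= k)%N, (size q <= l)%N,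
    forall x, x \in s -> p.[x] = f x * q.[x]
    & ~~ (all (root p) s)].
Proof.
move=> us f0 ks ls skl.
(* A row vector in the left kernel of the stacked matrix holds the coefficients of p and q with p -
   f q = 0 on [s]. *)
pose M1 := \matrix_(a < k, j < size s) s`_j ^+ a.
pose M2 := \matrix_(a < l, j < size s) (- (f s`_j * s`_j ^+ a)).
have : kermx (col_mx M1 M2) != 0.
  rewrite kermx_eq0 /row_free; apply: contraTneq skl => <-.
  by rewrite -leqNgt rank_leq_col.
case/rowV0Pn => c /sub_kermxP; rewrite -{1}[c]hsubmxK mul_row_col => cM c0.
set p := rVpoly (lsubmx c); set q := rVpoly (rsubmx c).
have pq x : x \in s -> p.[x] = f x * q.[x].
  move=> /(nthP 0)[j js <-]; move/matrixP/(_ 0 (Ordinal js)): cM.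
  rewrite !mxE /= => cM; apply/subr0_eq; rewrite -[RHS]cM !horner_rVpoly_sum.
  rewrite mulr_sumr -sumrN; congr (_ + _); apply: eq_bigr => a _.
    by rewrite [M1 _ _]mxE.
  by rewrite [M2 _ _]mxE /= mulrN mulrCA.
exists p, q; split; rewrite ?size_poly //.
(* If p vanishes on [s], the size bound gives p = 0; as f has no zero on [s], q vanishes there too,
   and the kernel vector is zero. *)
apply: contraNN c0 => ps.
have p0 : p = 0 by apply: poly_eq0_of_roots us ps _; apply: leq_trans (size_poly _ _) ks.
suff q0 : q = 0 by rewrite -[c]hsubmxK (rVpoly_eq0 p0) (rVpoly_eq0 q0) row_mx0.
apply: poly_eq0_of_roots us _ _; last by apply: leq_trans (size_poly _ _) ls.
apply/allP => x xs; have /eqP := pq x xs.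
by rewrite p0 horner0 eq_sym mulf_eq0 (negPf (f0 x xs)).
Qed.

(** * From strong cospectrality to the distance partition *)

Section Converse.
Variables (R : rcfType) (n : nat) (e : rel 'I_n.+1).
Hypotheses (e_sym : symmetric e) (e_conn : connected_graph e).
Variable E : R -> 'M[R]_n.+1.
Hypothesis E_proj : spectral_projections e E.
Local Notation A := (adj R e).
Local Notation evec := (evec R).
Local Notation dist := (dist e).
Local Notation at_vertex p u := (horner_mx A p *m evec u).

Variable phi : 'cV[R]_n.+1.
Hypothesis phi_gt0 : forall i, 0 < phi i ord0.

(* Subtracting the largest multiple of phi that keeps the eigenvector
   nonnegative creates a zero entry, which spreads along the edges. *)
Lemma positive_eigenvector_simple rho (y : 'cV[R]_n.+1) :
  A *m phi = rho *: phi -> A *m y = rho *: y -> exists c, y = c *: phi.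
Proof.
move=> Aphi Ay; pose F i := y i 0 / phi i 0.
have [i0 _ i0min] := @Order.TotalTheory.arg_minP _ _ _ ord0 xpredT F isT.
exists (F i0); set c := F i0; pose z := y - c *: phi.
have Az : A *m z = rho *: z.
  by rewrite mulmxBr -scalemxAr Ay Aphi scalerBr !scalerA mulrC.
have z_ge0 w : 0 <= z w 0.
  by rewrite !mxE subr_ge0 -ler_pdivlMr // i0min.
have z0 w : z w 0 = 0.
  move: {-1}(dist i0 w) (erefl (dist i0 w)) => k; elim: k w => [|k IH] w kw.
    move/eqP: kw; rewrite dist_eq0 // => /eqP ->.
    by rewrite !mxE /c /F divfK ?subrr // gt_eqF //; apply: phi_gt0.
  have [x /IH x0 exw] := dist_pred e_conn kw.
  have : (A *m z) x 0 = 0 by rewrite Az mxE x0 mulr0.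
  by rewrite adj_mul_col => /psumr_eq0P; apply.
by apply/subr0_eq/matrixP => w k; rewrite (ord1 k) z0 mxE.
Qed.

Variables u v : 'I_n.+1.
Hypothesis strong : strongly_cospectral E u v.
Local Notation d := (ecc e u).
Hypothesis duv : dist u v = d.
Variable s : seq R.
Hypotheses (s_uniq : uniq s) (s_supp : eigenvalue_support E (evec u) s)
  (s_size : size s = d.+1).

(** The sign in strong cospectrality; it is +1 off the support, where both projections vanish. *)
Let sgn th : R := if E th *m evec u == E th *m evec v then 1 else -1.

Let sgnE th : E th *m evec v = sgn th *: (E th *m evec u).
Proof.
rewrite /sgn; case: eqP => [->|ne]; first by rewrite scale1r.
by case: (strong th) => // ->; rewrite scaleN1r opprK.
Qed.

Lemma strongly_cospectral_cospectral : cospectral R e u v.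
Proof.
apply/(cospectral_proj (adj_sym R e_sym) E_proj) => th.
rewrite !(proj_evec_diag E_proj); apply: eq_bigr => w _.
by case: (strong th) => ->; rewrite // [X in X ^+ 2]mxE sqrrN.
Qed.

Lemma proj_separates (x y : 'cV[R]_n.+1) :
  (forall th, E th *m x = E th *m y) -> x = y.
Proof.
move=> xy; have [rs [_ rs1]] := sum_proj (adj_sym R e_sym) E_proj.
rewrite -[x]mul1mx -[y]mul1mx -rs1 !mulmx_suml.
by apply: eq_bigr => r _.
Qed.

Lemma layers_opposite w : (d <= dist u w + dist v w)%N.
Proof. by rewrite -duv (dist_sym e_sym e_conn v w) dist_triangle. Qed.

(** p(u) = q(v) means p = [sgn] q on the support. Interpolation has (i+1) + (d-i+1) = d+2 unknowns
    against d+1 conditions. The degrees bound the distances by i and d-i, and the triangle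
    inequality makes both bounds equalities. *)
Lemma geodesic_layer_vector (i : 'I_d.+1) : exists p : {poly R},
  (exists w, (at_vertex p u) w 0 != 0) /\
  forall w, (at_vertex p u) w 0 != 0 -> dist u w = i /\ dist v w = (d - i)%N.
Proof.
have id : (i <= d)%N by rewrite -ltnS ltn_ord.
have [||||p [q [sp sq pq ps]]] :=
    @pade_interpolation R s sgn i.+1 (d - i).+1 s_uniq.
- by move=> x _; rewrite /sgn; case: ifP; rewrite ?oppr_eq0 oner_eq0.
- by rewrite s_size ltnS.
- by rewrite s_size ltnS leq_subr.
- by rewrite s_size addSn addnS subnKC.
have uv : at_vertex p u = at_vertex q v.
  apply: proj_separates => th.
  rewrite !mulmxA !(mul_proj_horner E_proj) -!scalemxAl sgnE scalerA.
  have [/pq ->|] := boolP (th \in s); first by rewrite mulrC.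
  by rewrite s_supp negbK => /eqP ->; rewrite !scaler0.
exists p; split.
  move: ps; rewrite -(horner_mx_vec_eq0 (adj_sym R e_sym) E_proj _ s_supp).
  by move=> /cV0Pn.
move=> w pw.
have ui : (dist u w <= i)%N.
  by rewrite leqNgt; apply: contraNN pw => h; rewrite (horner_adj_eq0 e_sym e_conn sp h).
have vi : (dist v w <= d - i)%N.
  by rewrite leqNgt; apply: contraNN pw => h; rewrite uv (horner_adj_eq0 e_sym e_conn sq h).
by have := layers_opposite w; lia.
Qed.

(** g(A) e_u depends only on the d+1 values of g on the support. The square matrix [N] of the values
    of the [P i] is invertible because the vectors have disjoint supports, so [c] solves for the
    coefficients. *)
Lemma geodesic_layer_basis : exists P : 'I_d.+1 -> {poly R},
  (forall i w, (at_vertex (P i) u) w 0 != 0 ->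
      dist u w = i /\ dist v w = (d - i)%N) /\
  forall g, exists b : 'I_d.+1 -> R, at_vertex g u = \sum_i b i *: at_vertex (P i) u.
Proof.
have [P PP] := fin_all_exists geodesic_layer_vector.
exists P; split; first by move=> i w; have [_] := PP i; apply.
have act0 p : (forall j : 'I_d.+1, p.[s`_j] = 0) -> at_vertex p u = 0.
  move=> h; apply/eqP; rewrite (horner_mx_vec_eq0 (adj_sym R e_sym) E_proj _ s_supp).
  apply/(all_nthP 0) => j; rewrite s_size => jd.
  by apply/rootP; apply: (h (Ordinal jd)).
have actsum (b : 'I_d.+1 -> R) :
    at_vertex (\sum_i b i *: P i) u = \sum_i b i *: at_vertex (P i) u.
  rewrite rmorph_sum mulmx_suml; apply: eq_bigr => i _.
  by rewrite /= horner_mxZ scalemxAl.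
pose N := \matrix_(i < d.+1, j < d.+1) (P i).[s`_j].
have hN (c : 'rV_d.+1) j : (c *m N) 0 j = (\sum_i c 0 i *: P i).[s`_j].
  by rewrite mxE horner_sum; apply: eq_bigr => i _; rewrite mxE hornerZ.
have Nunit : N \in unitmx.
  rewrite -row_free_unit; apply: inj_row_free => c cN.
  apply/rowP => i; rewrite [RHS]mxE; have [[w xw] iw] := PP i.
  have : at_vertex (\sum_k c 0 k *: P k) u = 0.
    by apply: act0 => j; rewrite -hN cN mxE.
  rewrite actsum => /matrixP/(_ w 0); rewrite summxE mxE (bigD1 i) //= big1.
    by rewrite addr0 mxE => /eqP; rewrite mulf_eq0 (negPf xw) orbF => /eqP.
  move=> k ki; rewrite mxE; have [->|xk] := eqVneq ((at_vertex (P k) u) w 0) 0.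
    by rewrite mulr0.
  have [_ /(_ _ xk)[kw _]] := PP k; have [iw' _] := iw w xw.
  by move: ki; rewrite -(inj_eq val_inj) /= -kw -iw' eqxx.
move=> g; pose c := \row_j g.[s`_(j : 'I_d.+1)] *m invmx N.
exists (fun i => c 0 i); apply/subr0_eq; rewrite -actsum -mulmxBl -rmorphB.
by apply: act0 => j; rewrite hornerD hornerN -hN mulmxKV // mxE subrr.
Qed.

(** rho lies in the support because phi has a positive entry at u. A polynomial killing the other
    support eigenvalues sends e_u to a nonzero rho-eigenvector, a multiple of phi by simplicity. *)
Lemma perron_at_vertex rho : A *m phi = rho *: phi ->
  exists g : {poly R}, phi = at_vertex g u.
Proof.
move=> Aphi.
have rs : rho \in s.
  rewrite s_supp; apply/eqP => E0.
  have : (phi^T *m (E rho *m evec u)) 0 0 = 0 by rewrite E0 mulmx0 mxE.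
  rewrite mulmxA -{1}(trmx_proj E_proj) -trmx_mul (proj_fix (adj_sym R e_sym) E_proj Aphi).
  by rewrite -colE !mxE => p0; have := phi_gt0 u; rewrite p0 ltxx.
pose g := \prod_(t <- rem rho s) ('X - t%:P).
have gu : at_vertex g u != 0.
  rewrite (horner_mx_vec_eq0 (adj_sym R e_sym) E_proj _ s_supp).
  apply/allPn; exists rho => //.
  by rewrite root_prod_XsubC mem_rem_uniq // inE eqxx.
have Ag : A *m (at_vertex g u) = rho *: (at_vertex g u).
  apply/subr0_eq; rewrite -[_ *: _]mul_scalar_mx -mulmxBl.
  have -> : A - rho%:M = horner_mx A ('X - rho%:P).
    by rewrite rmorphB /= horner_mx_X horner_mx_C.
  have sE : ('X - rho%:P) * g = \prod_(t <- s) ('X - t%:P).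
    by rewrite (big_rem _ rs).
  rewrite mulmxA -[_ *m horner_mx A g]rmorphM sE.
  apply/eqP; rewrite (horner_mx_vec_eq0 (adj_sym R e_sym) E_proj _ s_supp).
  by apply/allP => t ts; rewrite root_prod_XsubC.
have [c gc] := positive_eigenvector_simple Aphi Ag.
have c0 : c != 0 by apply: contraNneq gu => c0; rewrite gc c0 scale0r.
by exists (c^-1 *: g); rewrite horner_mxZ -scalemxAl gc scalerA mulVf ?scale1r.
Qed.

Lemma extremal_strongly_cospectral_antipodal rho :
  A *m phi = rho *: phi -> antipodal e phi u v.
Proof.
move=> Aphi; have [P [Pgeo Pbasis]] := geodesic_layer_basis.
have [g phig] := perron_at_vertex Aphi; have [b] := Pbasis g.
rewrite -phig => phib.
have lt_d w : (dist u w < d.+1)%N by rewrite ltnS dist_le_ecc.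
pose lay w : 'I_d.+1 := Ordinal (lt_d w).
have Pw i w : i != lay w -> (at_vertex (P i) u) w 0 = 0.
  by move=> iw; apply: contraNeq iw => /Pgeo[] ? _; apply/eqP/val_inj.
have comb (c : 'I_d.+1 -> R) w :
    (\sum_i c i *: at_vertex (P i) u) w 0
    = c (lay w) * (at_vertex (P (lay w)) u) w 0.
  rewrite summxE (bigD1 (lay w)) //= mxE big1 ?addr0 // => i /Pw h.
  by rewrite mxE h mulr0.
have phiw w : phi w 0 = b (lay w) * (at_vertex (P (lay w)) u) w 0.
  by rewrite [in LHS]phib comb.
(* Positivity of phi makes every factor nonzero, so each vertex is in the support of its layer's
   vector and hence on a geodesic from u to v. *)
have [b0 P0] : (forall w, b (lay w) != 0)
    /\ (forall w, (at_vertex (P (lay w)) u) w 0 != 0).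
  by split=> w; have := phi_gt0 w; rewrite phiw => /gt_eqF/negbT; rewrite mulf_eq0 negb_or => /andP[].
have vw w : dist v w = (d - dist u w)%N by have [_ ->] := Pgeo _ _ (P0 w).
have vv w : (dist u w == d) = (w == v).
  by rewrite -(dist_eq0 e_conn) vw subn_eq0 eqn_leq dist_le_ecc.
split=> //.
- apply: eq_imset => x; apply/setP => w; rewrite !inE !vw.
  by rewrite eqn_sub2lE ?dist_le_ecc.
- move=> _ _ /imsetP[c _ ->] /imsetP[a _ ->] x y; rewrite !inE => /eqP xa /eqP ya.
  set S := [set _ | _].
  have [k kE] := Pbasis ('X * P (lay c)).
  have layE : layer e phi u (dist u c) = b (lay c) *: at_vertex (P (lay c)) u.
    apply/matrixP => w j; rewrite (ord1 j) [LHS]mxE [RHS]mxE.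
    case: eqP => [wc|wc]; first by rewrite mulr1n phiw; have -> : lay w = lay c by apply: val_inj.
    by rewrite Pw ?mulr0 //; apply/eqP => /(congr1 val) /= cw; apply: wc.
  (* Expanding A x_i in the basis leaves one term at w, with the coefficient indexed by its layer;
     dividing by phi cancels the rest of the dependence on w. *)
  have sumE w : \sum_(z in S) DAD e phi w z = b (lay c) * k (lay w) / b (lay w).
    apply: (@mulfI _ (phi w 0)); first by rewrite gt_eqF // phi_gt0.
    rewrite -(adj_layer e u phi_gt0) layE -scalemxAr mulmxA.
    have -> : A *m horner_mx A (P (lay c)) = horner_mx A ('X * P (lay c)).
      by rewrite rmorphM /= horner_mx_X.
    by rewrite mxE kE comb phiw; field; apply: b0.
  by rewrite !sumE; have -> : lay x = lay y by apply: val_inj; rewrite /= xa.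
- split; apply/imsetP; [exists u | exists v] => //; apply/setP => w; rewrite !inE.
    have /eqP -> : dist u u == 0%N by rewrite dist_eq0.
    by rewrite dist_eq0.
  by rewrite duv vv.
- exact: strongly_cospectral_cospectral.
Qed.

End Converse.

Theorem theorem3p3 (R : rcfType) (n : nat) (e : rel 'I_n.+1)
    (E : R -> 'M[R]_n.+1) (phi : 'cV[R]_n.+1) (u v : 'I_n.+1) :
  simple_graph e -> connected_graph e ->
  spectral_projections e E -> perron_vector e phi ->
  (antipodal e phi u v ->
     [/\ spectrally_extremal e E u, spectrally_extremal e E v
       & strongly_cospectral E u v]) /\
  (spectrally_extremal e E u -> strongly_cospectral E u v ->
     dist e u v = ecc e u -> antipodal e phi u v).
Proof.
move=> [e_sym _] e_conn E_proj [phi_gt0 [rho [Aphi _]]]; split.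
  case=> Puv Pu [_ /imsetP[x _ vx]] _ cuv; split.
  - exact: pseudo_equitable_extremal phi_gt0 Pu.
  - by rewrite Puv in Pu; apply: pseudo_equitable_extremal phi_gt0 Pu.
  (* The class equal to {v} contains v, so it is the distance class of v. *)
  have vC : [set w | dist e u w == dist e u v] = [set v].
    by have := set11 v; rewrite vx inE => /eqP ->.
  have [q quv] := singleton_layer_poly e_sym e_conn phi_gt0 Pu vC.
  exact: cospectral_strongly quv cuv.
move=> [s [s_uniq /(eigenvalue_supportP E_proj) s_supp s_size]] strong duv.
have s_gt := ecc_lt_support e_sym e_conn E_proj s_uniq s_supp.
apply: extremal_strongly_cospectral_antipodal s_uniq s_supp _ _ Aphi => //.
(* The support is nonempty, so the truncated predecessor can be inverted. *)
by rewrite -s_size prednK // (leq_trans _ s_gt).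
Qed.
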